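(* Let $k\ge 2$ and $n\ge 0$ be integers. Then $$N_{0,k}(n)=P_{2,1}(n,k)\qquad\text{and}\qquad N_{1,k}(n)=\bar{P}_{2,1}(n,k).$$
   Context: A $k$-color partition of $n$ is a finite multiset of positive integers (parts), each carrying one of the $k$ colors $color(1),\dots,color(k)$, whose sum is $n$; repetitions are allowed. $\mathcal{N}_k(n)$ is the set of $k$-color partitions of $n$ in which even parts may occur only in the $k-1$ colors $color(2),\dots,color(k)$ (odd parts may occur in all $k$ colors). $N_{0,k}(n)$ (resp. $N_{1,k}(n)$) is the number of partitions in $\mathcal{N}_k(n)$ in which the number of parts in $color(k)$, counted with multiplicity, is even (resp. odd). For a $k$-color partition $\lambda$ of $n$ in which parts $\equiv 0\pmod 2$ occur only in $color(2),\dots,color(k)$, i.e. $\lambda\in\mathcal{N}_k(n)$, let $\mathrm{mex}_{2,1}(\lambda,k)$ be the smallest positive integer $\equiv 1\pmod 2$ that does not occur as a part in $color(k)$ of $\lambda$. $P_{2,1}(n,k)$ (resp. $\bar{P}_{2,1}(n,k)$) is the number of such $\lambda$ with $\mathrm{mex}_{2,1}(\lambda,k)\equiv 1\pmod 4$ (resp. $\equiv 3\pmod 4$). *)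

(* Defs.v *)
From HB Require Import structures.
From mathcomp Require Import all_boot finmap multiset.

Set Implicit Arguments.
Unset Strict Implicit.
Unset Printing Implicit Defensive.

Local Open Scope mset_scope.
Local Open Scope nat_scope.

(* A colored part (i, c) has size i; its color is numbered from 1 to k,
   whereas c : 'I_k is numbered from 0. *)
Definition color k (p : nat * 'I_k) : nat := p.2.+1.

Definition is_cpart (k n : nat) (la : {mset nat * 'I_k}) : bool :=
  all (fun p => 0 < p.1) la && (\sum_(p <- la) p.1 == n).

Record cpart (k n : nat) := CPart {
  parts :> {mset nat * 'I_k};
  partsP : is_cpart n parts }.

HB.instance Definition _ k n := [isSub for @parts k n].
HB.instance Definition _ k n := [Choice of cpart k n by <:].

(* Finiteness: sizes and multiplicities of the parts are at most n. *)
Section CPartFinite.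
Variables k n : nat.

Definition mult_of (la : cpart k n) : {ffun 'I_n.+1 * 'I_k -> 'I_n.+1} :=
  [ffun x => inord (parts la (val x.1, x.2))].

Definition mset_of_mult (f : {ffun 'I_n.+1 * 'I_k -> 'I_n.+1}) :
    {mset nat * 'I_k} :=
  seq_mset (flatten [seq nseq (f x) (val x.1, x.2) | x : 'I_n.+1 * 'I_k]).

Lemma cpart_mult_le (la : cpart k n) p : parts la p * p.1 <= n.
Proof.
have [pla|/mset_eq0P -> //] := boolP (p \in parts la).
have /andP[_ /eqP sumn] := partsP la.
rewrite -[leqRHS]sumn sum_mset (big_fsetD1 p) ?msuppE //=; exact: leq_addr.
Qed.

Lemma cpart_part_gt0 (la : cpart k n) p : p \in parts la -> 0 < p.1.
Proof. by have /andP[/allP h _] := partsP la; exact: h. Qed.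

Lemma mult_ofK :
  pcancel mult_of (fun f => insub (mset_of_mult f) : option (cpart k n)).
Proof.
move=> la; suff -> : mset_of_mult (mult_of la) = parts la by rewrite valK.
apply/msetP => p; rewrite mset_seqE count_flatten -map_comp sumn_map big_enum /=.
have [pla|npla] := boolP (p \in parts la); last first.
  rewrite (mset_eq0P npla) big1 // => x _ /=; rewrite count_nseq /= ffunE.
  case: eqP => [e|_]; last by rewrite mul0n.
  by rewrite e (mset_eq0P npla) inordK.
have p0 := cpart_part_gt0 pla; have := cpart_mult_le la p => lepn.
have la0 : 0 < parts la p by rewrite mset_gt0.
have lt1 : p.1 < n.+1 by rewrite ltnS (leq_trans _ lepn) // leq_pmull.
have lt2 : parts la p < n.+1 by rewrite ltnS (leq_trans _ lepn) // leq_pmulr.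
rewrite (bigD1 (Ordinal lt1, p.2)) //= count_nseq ffunE /= -surjective_pairing.
rewrite eqxx mul1n inordK // big1 ?addn0 // => -[x c] ne; rewrite count_nseq /=.
case: eqP => [e|_]; last by rewrite mul0n.
case/eqP: ne; apply/eqP; rewrite xpair_eqE -(inj_eq val_inj) /=.
by rewrite -{}e !eqxx.
Qed.

End CPartFinite.

HB.instance Definition _ k n := [Countable of cpart k n by <:].
HB.instance Definition _ k n : isFinite (cpart k n) :=
  PCanIsFinite (@mult_ofK k n).

Definition calN (k n : nat) : {set cpart k n} :=
  [set la : cpart k n | all (fun p => ~~ odd p.1 ==> (2 <= color p)) (parts la)].

Definition nb_last_color (k n : nat) (la : cpart k n) : nat :=
  count (fun p => color p == k) (parts la).

Definition N0 (k n : nat) : nat := #|[set la in calN k n | ~~ odd (nb_last_color la)]|.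
Definition N1 (k n : nat) : nat := #|[set la in calN k n | odd (nb_last_color la)]|.

Definition mex21_cand (k n : nat) (la : cpart k n) (m : nat) : bool :=
  [&& 0 < m, odd m
    & ~~ has (fun p => (p.1 == m) && (color p == k)) (parts la)].

Lemma mex21_exists (k n : nat) (la : cpart k n) : exists m, mex21_cand la m.
Proof.
exists n.*2.+1; rewrite /mex21_cand /= odd_double /=; apply/hasPn => p pla.
rewrite negb_and; apply/orP; left; rewrite neq_ltn; apply/orP; left.
have lepn := cpart_mult_le la p.
apply: (@leq_ltn_trans n); last by rewrite ltnS -addnn leq_addr.
by rewrite (leq_trans _ lepn) // leq_pmull // mset_gt0.
Qed.

Definition mex21 (k n : nat) (la : cpart k n) : nat := ex_minn (mex21_exists la).

Definition P21 (k n : nat) : nat := #|[set la in calN k n | mex21 la == 1 %[mod 4]]|.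
Definition P21bar (k n : nat) : nat := #|[set la in calN k n | mex21 la == 3 %[mod 4]]|.

(* Main.v *)
(* Only color k matters: the parts of the other colors contribute the same
   factor to every generating function, because color 1 <> color k. Hence
   N_0 - N_1 = P - Pbar reduces to theta(-q) / (q;q) = 1 / (-q;q), that is, to
   Gauss' identity 1 + 2 sum_(j >= 1) (-1)^j q^(j^2) = (q;q) / (-q;q): the parts
   of color k weighted by (-1)^(number of parts) give 1 / (-q;q), and writing
   (-1)^r = 1 + 2 sum_(1 <= m <= r) (-1)^m for mex = 2r+1 gives theta(-q) / (q;q),
   as forcing 1, 3, ..., 2m-1 to occur costs a factor q^(1+3+...+(2m-1)) = q^(m^2).
   Since N_0 + N_1 = P + Pbar, equality of the differences suffices.
   Gauss' identity is proved by a finite version in the style of Shanks. *)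

Require Import Defs.
From mathcomp Require Import all_boot all_algebra ring zify finmap multiset.

Set Implicit Arguments.
Unset Strict Implicit.
Unset Printing Implicit Defensive.

Import GRing.Theory.
Local Open Scope ring_scope.

(** * A finite form of Gauss' identity *)

Section FiniteGauss.
Variables (R : comNzRingType) (x : R).

(** The summand at [s] is the right-hand side at [s] minus the one at [s - 1]; at [s = 0] nothing
    precedes, and [1 - x^0] vanishes. *)
Lemma shanks_telescope (n m : nat) : (m < n)%N ->
  \sum_(s < m.+1) (-1) ^+ s * x ^+ (s * n) * (1 - x ^+ s + x ^+ n * (1 + x ^+ s.+1)) *
    (\prod_(s.+1 <= i < n) (1 - x ^+ i) * \prod_(1 <= i < s.+1) (1 + x ^+ i))
  = (-1) ^+ m * x ^+ (m.+1 * n) *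
    (\prod_(m.+1 <= i < n) (1 - x ^+ i) * \prod_(1 <= i < m.+2) (1 + x ^+ i)).
Proof.
elim: m => [|m IH] mn.
  rewrite big_ord1 big_nat1 [X in _ * (_ * X) = _]big_geq // mul0n mul1n expr0 /=.
  by move: (\prod_(_ <= _ < _) _) => P; ring.
rewrite big_ord_recr /= IH 1?ltnW // (big_nat_recr m.+2) //= (big_ltn mn) /=.
rewrite [(m.+2 * n)%N]mulSn exprD.
move: (x ^+ (m.+1 * n)) (x ^+ n) (x ^+ m.+1) (x ^+ m.+2) => a b c d.
set P := \prod_(m.+2 <= i < n) _; set Q := \prod_(1 <= i < m.+2) _.
by rewrite exprS mulN1r; move: (_ ^+ m) P Q => e P Q; ring.
Qed.

(* Modulo x^(n+1), only the term s = 0, namely (x;x)_n, survives on the right. *)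
Lemma finite_gauss (n : nat) :
  (1 + \sum_(1 <= j < n.+1) (-1) ^+ j * x ^+ (j ^ 2) *+ 2
     + (-1) ^+ n.+1 * x ^+ (n.+1 ^ 2)) * \prod_(1 <= i < n.+1) (1 + x ^+ i) =
  (1 - x ^+ n.+1) * \sum_(s < n.+1) (-1) ^+ s * x ^+ (s * n.+1) *
    (\prod_(s.+1 <= i < n.+1) (1 - x ^+ i) * \prod_(1 <= i < s.+1) (1 + x ^+ i)).
Proof.
elim: n => [|n IH].
  by rewrite big_ord1 !big_geq //; ring.
rewrite big_nat_recr //= (big_nat_recr n.+1) //=.
rewrite (_ : \sum_(s < n.+2) _ =
   (-1) ^+ n.+1 * x ^+ (n.+1 * n.+2) * \prod_(1 <= i < n.+2) (1 + x ^+ i)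
   + (1 - x ^+ n.+1) * \sum_(s < n.+1) (-1) ^+ s * x ^+ (s * n.+1) * x ^+ s *
    (\prod_(s.+1 <= i < n.+1) (1 - x ^+ i) * \prod_(1 <= i < s.+1) (1 + x ^+ i)));
  last first.
  rewrite big_ord_recr /= addrC; congr (_ + _).
    by rewrite (@big_geq _ _ _ n.+2) // mul1r.
  rewrite big_distrr /=; apply: eq_bigr => s _.
  rewrite [X in x ^+ X]mulnS addnC exprD (@big_nat_recr _ _ _ n.+1) //=.
  by move: (\prod_(_ <= i < n.+1) _) (\prod_(_ <= i < s.+1) _) => P Q; ring.
set S0 := \sum_(s < n.+1) _ in IH; set S1 := \sum_(s < n.+1) _.
(* Termwise, [(1 + x^(n+1)) - (1 - x^(n+2)) x^s] is the bracket [1 - x^s + x^(n+1) (1 + x^(s+1))] of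
   [shanks_telescope], taken at [n.+1] and [m = n]. *)
have S1E : (1 - x ^+ n.+2) * S1 =
    (1 + x ^+ n.+1) * S0
    - (-1) ^+ n * x ^+ (n.+1 * n.+1) * \prod_(1 <= i < n.+2) (1 + x ^+ i).
  have := shanks_telescope (ltnSn n).
  rewrite (@big_geq _ _ _ n.+1 n.+1) // mul1r => <-.
  rewrite !big_distrr -sumrB; apply: eq_bigr => s _ /=.
  rewrite ![x ^+ _.+1]exprS.
  by move: (\prod_(_ <= i < n.+1) _) (\prod_(_ <= i < s.+1) _) => P Q; ring.
have e1 : (n.+1 * n.+2 = n.+1 * n.+1 + n.+1)%N by rewrite -mulnSr.
have e2 : (n.+2 ^ 2 = n.+1 * n.+1 + n.+1 + n.+2)%N by rewrite -e1 addnC -mulSn.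
rewrite [in RHS]mulrDr [_ * (_ * S1)]mulrCA S1E e2 e1 !exprD.
rewrite (big_nat_recr n.+1) //= [(-1) ^+ n.+2]exprS; move: IH.
have -> : (-1) ^+ n = - (-1) ^+ n.+1 :> R by rewrite exprS mulN1r opprK.
rewrite -[(n.+1 ^ 2)%N]/(n.+1 * n.+1)%N.
set T := \sum_(1 <= j < n.+1) _; set B := \prod_(1 <= i < n.+1) _.
move: ((-1) ^+ _) (x ^+ (_ * _)) => e b IH.
transitivity ((1 + T + e * b) * B * (1 + x ^+ n.+1)
  + (e * b - e * b * x ^+ n.+1 * x ^+ n.+2) * B * (1 + x ^+ n.+1)).
  by ring.
by rewrite IH; ring.
Qed.

End FiniteGauss.

Local Open Scope nat_scope.

(** * Multiplicity functions and the generating function of [calN] *)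

Section Mult.
Variables k n : nat.
Implicit Types (x : 'I_n.+1 * 'I_k) (la : cpart k n).
Implicit Type f : {ffun 'I_n.+1 * 'I_k -> 'I_n.+1}.

(* Index of a multiplicity in [mult_of]; the cells with x.1 = 0 have size 0 and
   carry no part, which is why [allowed] below excludes them. *)
Definition cell x : nat * 'I_k := (val x.1, x.2).

Lemma cell_inj : injective cell.
Proof. by move=> [i c] [j d] [/val_inj -> ->]. Qed.

Definition allowed (p : nat * 'I_k) :=
  (0 < p.1) && (~~ odd p.1 ==> (2 <= color p)).

Lemma mset_of_mult_cell f x : mset_of_mult f (cell x) = f x.
Proof.
rewrite mset_seqE count_flatten -map_comp sumn_map big_enum /=.
rewrite (bigD1 x) //= count_nseq /= eqxx mul1n big1 ?addn0 // => y yx.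
by rewrite count_nseq /= (inj_eq cell_inj) (negbTE yx).
Qed.

Lemma mset_of_multP f p :
  reflect (exists2 x, p = cell x & 0 < f x) (p \in mset_of_mult f).
Proof.
rewrite (perm_mem (perm_eq_seq_mset _)).
apply: (iffP flattenP) => [[_ /imageP[x _ ->]]|[x -> fx]].
  by rewrite mem_nseq => /andP[fx /eqP->]; exists x.
by exists (nseq (f x) (cell x)); rewrite ?mem_nseq ?fx ?eqxx //; apply: image_f.
Qed.

Lemma big_mset_of_mult f (F : nat * 'I_k -> nat) :
  \sum_(p <- mset_of_mult f) F p = \sum_x f x * F (cell x).
Proof.
rewrite (perm_big _ (perm_eq_seq_mset _)) big_flatten big_image /=.
by apply: eq_bigr => x _; rewrite big_nseq iter_addn_0 mulnC.
Qed.

Lemma mset_of_mult_of la : mset_of_mult (mult_of la) = parts la.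
Proof. by have := mult_ofK la; case: insubP => // u _ <- [->]. Qed.

Lemma mult_ofE la x : mult_of la x = parts la (cell x) :> nat.
Proof. by rewrite -mset_of_mult_of mset_of_mult_cell. Qed.

Lemma mem_parts la p :
  p \in parts la -> exists2 x, p = cell x & 0 < parts la (cell x).
Proof.
rewrite -{1}mset_of_mult_of => /mset_of_multP[x -> fx]; exists x => //.
by rewrite -mult_ofE.
Qed.

(** [pfamily] with default [ord0] makes multiplicities vanish off the allowed cells; this is the
    index set that arises when a product of sums is expanded. *)
Lemma calNE la :
  (la \in calN k n) =
  (mult_of la \in pfamily ord0 [pred x | allowed (cell x)] (fun=> predT)).
Proof.
rewrite inE; apply/allP/pfamilyP => [laN|[/subsetP fs _] p].
  split=> //; apply/subsetP => x; rewrite !inE -val_eqE /= mult_ofE => la_x.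
  have xla : cell x \in parts la by rewrite -mset_gt0 lt0n.
  by rewrite /allowed (cpart_part_gt0 xla) laN.
case/mem_parts=> x -> la_x; have /andP[] // : allowed (cell x).
by apply: fs; rewrite !inE -val_eqE /= mult_ofE -lt0n.
Qed.

Lemma sum_mult_of la : \sum_x mult_of la x * x.1 = n.
Proof.
have /andP[_ /eqP sumn] := partsP la.
by rewrite -[RHS]sumn -mset_of_mult_of (big_mset_of_mult _ fst).
Qed.

Lemma calN_sum (R : nmodType) (F : {ffun 'I_n.+1 * 'I_k -> 'I_n.+1} -> R) :
  (\sum_(la in calN k n) F (mult_of la) =
   \sum_(f in pfamily ord0 [pred x | allowed (cell x)] (fun=> predT)
          | (\sum_x f x * x.1)%N == n) F f)%R.
Proof.
symmetry.
(* The inverse of [mult_of] is only partial: a multiplicity function gives a [cpart k n] only if its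
   sizes are positive and sum to [n]. *)
rewrite (reindex_omap (@mult_of k n)
  (fun f => insub (mset_of_mult f) : option (cpart k n))).
  by apply: eq_bigl => la; rewrite mult_ofK eqxx andbT calNE sum_mult_of eqxx andbT.
move=> f /andP[/pfamilyP[/subsetP fs _] fn].
have ispart : is_cpart n (mset_of_mult f).
  rewrite /is_cpart (big_mset_of_mult f fst) fn andbT.
  apply/allP => _ /mset_of_multP[x -> fx].
  have /andP[] // : allowed (cell x).
  by apply: fs; rewrite !inE -val_eqE /= -lt0n.
rewrite insubT /=; congr Some; apply/ffunP => x; apply: val_inj.
by rewrite /= mult_ofE /= mset_of_mult_cell.
Qed.

(** Expanding the product chooses a multiplicity for each allowed cell, and the coefficient of [X^n]
    keeps the choices of total size [n]. No multiplicity exceeds [n], so the truncated sums lose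
    nothing. *)
Lemma calN_genfun (R : comNzRingType) (v : nat * 'I_k -> nat -> R) :
  (\sum_(la in calN k n) \prod_(x | allowed (cell x)) v (cell x) (parts la (cell x)) =
   (\prod_(x | allowed (cell x)) \sum_(j < n.+1) v (cell x) j *: 'X^(j * x.1))`_n)%R.
Proof.
rewrite (big_distr_big_dep ord0) coef_sum /=.
under eq_bigr do under eq_bigr do rewrite -mult_ofE.
rewrite (calN_sum (fun f => \prod_(x | allowed (cell x)) v (cell x) (f x)))%R.
rewrite big_mkcondr /=; apply: eq_bigr => f /pfamilyP[/subsetP fs _].
rewrite scaler_prod coefZ -expr_sum coefXn [_ == n]eq_sym.
suff -> : \sum_x f x * x.1 = \sum_(x | allowed (cell x)) f x * x.1.
  by case: ifP => _; rewrite ?mulr1 ?mulr0.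
rewrite [LHS](bigID (fun x => allowed (cell x))) /= [X in _ + X]big1 ?addn0 //.
move=> x nx; suff -> : f x = ord0 by [].
by apply/eqP; apply: contraNT nx => fx; apply: fs; rewrite !inE.
Qed.

End Mult.

Local Open Scope ring_scope.

(** * Power series modulo [X^N], and Gauss' identity there *)

Section Trunc.
Variables (R : comNzRingType) (N : nat).
Implicit Types p q r : {poly R}.

(* Equality of power series modulo X^N. *)
Definition eqX p q := forall i, (i < N)%N -> p`_i = q`_i.

Lemma eqX_sym p q : eqX p q -> eqX q p.
Proof. by move=> pq i iN; rewrite pq. Qed.

Lemma eqX_trans p q r : eqX p q -> eqX q r -> eqX p r.
Proof. by move=> pq qr i iN; rewrite pq // qr. Qed.

Lemma eqXD p p' q q' : eqX p p' -> eqX q q' -> eqX (p + q) (p' + q').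
Proof. by move=> pp qq i iN; rewrite !coefD pp ?qq. Qed.

Lemma eqXM p p' q q' : eqX p p' -> eqX q q' -> eqX (p * q) (p' * q').
Proof.
move=> pp qq i iN; rewrite !coefM; apply: eq_bigr => j _.
by rewrite pp ?qq //; have := ltn_ord j; lia.
Qed.

Lemma eqX_prod (I : Type) (r : seq I) (P : pred I) (F G : I -> {poly R}) :
  (forall i, P i -> eqX (F i) (G i)) ->
  eqX (\prod_(i <- r | P i) F i) (\prod_(i <- r | P i) G i).
Proof. by move=> FG; elim/big_ind2: _ => // *; exact: eqXM. Qed.

Lemma eqX_addX p q m : (N <= m)%N -> eqX (p + 'X^m * q) p.
Proof.
move=> Nm i iN; rewrite coefD coefXnM.
by rewrite (leq_trans iN) // addr0.
Qed.

(** The product telescopes to [1 - e^m X^(a m)], and [a m >= N]. *)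
Lemma eqX_geometric (e : R) a m : (0 < a)%N -> (N <= m)%N ->
  eqX ((1 - e *: 'X^a) * \sum_(j < m) (e *: 'X^a) ^+ j) 1.
Proof.
move=> a0 Nm; rewrite -opprB mulNr -subrX1 opprB exprZn -exprM -mul_polyC.
rewrite mulrC -mulrN; apply: eqX_addX; rewrite (leq_trans Nm) //.
exact: leq_pmull.
Qed.

End Trunc.

(** In [finite_gauss] at [X], the terms [s >= 1], the correction in the prefactor [1 - X^(n+1)] and
    the boundary term in [X^((n+1)^2)] are all multiples of [X^(n+1)]. *)
Lemma eqX_gauss (R : comNzRingType) n :
  eqX n.+1 ((1 + \sum_(1 <= j < n.+1) (-1) ^+ j * 'X^(j ^ 2) *+ 2)
         * \prod_(1 <= i < n.+1) (1 + 'X^i))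
    (\prod_(1 <= i < n.+1) (1 - 'X^i) : {poly R}).
Proof.
have := finite_gauss ('X : {poly R}) n.
rewrite mulrDl big_ord_recl /= => /(canRL (addrK _)) ->.
set P := \prod_(1 <= i < n.+1) (1 - _); set Q := \prod_(1 <= i < n.+1) _.
rewrite [\sum_(i < n) _](_ : _ = 'X^(n.+1) *
    \sum_(i < n) (-1) ^+ i.+1 * 'X^(i * n.+1) *
      (\prod_(i.+2 <= j < n.+1) (1 - 'X^j) * \prod_(1 <= j < i.+2) (1 + 'X^j)));
  last first.
  rewrite big_distrr; apply: eq_bigr => i _; rewrite /bump add1n mulSn exprD /=.
  by rewrite !mulrA [_ * 'X^(n.+1)]mulrC.
rewrite big_geq // -[(n.+1 ^ 2)%N]/(n.+1 * n.+1)%N mulSn mul0n exprD.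
set S := \sum_(i < n) _; move: ((-1) ^+ n.+1) => e.
rewrite [X in eqX _ X](_ : _ = P + 'X^(n.+1) *
    ((1 - 'X^(n.+1)) * S - P - e * 'X^(n * n.+1) * Q)); last by ring.
exact: eqX_addX.
Qed.

(** The signed sum is the even count minus the odd count, while their total is [#|A|] for either
    statistic. *)
Lemma parity_count (T : finType) (A : {set T}) (h h' : T -> nat) :
  \sum_(x in A) (-1) ^+ h x = \sum_(x in A) (-1) ^+ h' x :> int ->
  #|[set x in A | ~~ odd (h x)]| = #|[set x in A | ~~ odd (h' x)]| /\
  #|[set x in A | odd (h x)]| = #|[set x in A | odd (h' x)]|.
Proof.
have sumE (f : T -> nat) : \sum_(x in A) (-1) ^+ f x =
    #|[set x in A | ~~ odd (f x)]|%:R - #|[set x in A | odd (f x)]|%:R :> int.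
  rewrite (bigID (fun x => odd (f x))) /= addrC.
  rewrite (eq_bigr (fun=> 1)); last first.
    by move=> x /andP[_ /negbTE fx]; rewrite -signr_odd fx.
  rewrite [X in _ + X](eq_bigr (fun=> -1)); last first.
    by move=> x /andP[_ fx]; rewrite -signr_odd fx.
  by rewrite sumrN -!sum1dep_card !natr_sum.
have cardE (f : T -> nat) :
    (#|[set x in A | ~~ odd (f x)]| + #|[set x in A | odd (f x)]| = #|A|)%N.
  rewrite -!sum1dep_card -[RHS]sum1_card [RHS](bigID (fun x => odd (f x))) /=.
  by rewrite addnC.
by rewrite !sumE; have := cardE h; have := cardE h'; lia.
Qed.

(** * Signed and constrained counts in the last color *)

Section LastColor.
Variables K n : nat.
Let k := K.+2.
Local Notation cell := (@cell k n).
Implicit Types (x : 'I_n.+1 * 'I_k) (la : cpart k n) (p : nat * 'I_k).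

Lemma color_last p : (color p == k) = (p.2 == ord_max).
Proof. by rewrite /color eqSS. Qed.

(** Since color [k] is not color 1, every size from 1 to [n] is allowed in it, whatever its
    parity. *)
Lemma prod_allowed (R : comNzRingType) (g : nat * 'I_k -> R) :
  \prod_(x | allowed (cell x)) g (cell x) =
  \prod_(x | allowed (cell x) && (x.2 != ord_max)) g (cell x)
  * \prod_(1 <= a < n.+1) g (a, ord_max).
Proof.
rewrite (bigID (fun x => x.2 == ord_max)) /= mulrC; congr (_ * _).
rewrite big_geq_mkord /=.
rewrite (reindex_onto (fun a : 'I_n.+1 => (a, ord_max : 'I_k)) fst) /=; last first.
  by move=> [a c] /= /andP[_ /eqP->].
by apply: eq_bigl => a; rewrite /allowed /cell /color /= !eqxx implybT !andbT.
Qed.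

Lemma nb_last_colorE la :
  nb_last_color la = (\sum_x parts la (cell x) * (x.2 == ord_max))%N.
Proof.
rewrite /nb_last_color -[in LHS]mset_of_mult_of -sum1_count big_mkcond /=.
rewrite (eq_bigr (fun p => (p.2 == ord_max) : nat)); last first.
  by move=> p _; rewrite color_last; case: eqP.
by rewrite (big_mset_of_mult (mult_of la) (fun p => (p.2 == ord_max) : nat));
  apply: eq_bigr => x _; rewrite mult_ofE.
Qed.

Lemma calN_allowed la x :
  la \in calN k n -> ~~ allowed (cell x) -> parts la (cell x) = 0%N.
Proof.
rewrite calNE => /pfamilyP[/subsetP fs _] nx; rewrite -mult_ofE.
suff -> : mult_of la x = ord0 by [].
by apply/eqP; apply: contraNT nx => fx; apply: fs; rewrite !inE.
Qed.

(** For [a > 0], the inverse of [1 - e X^a] modulo [X^(n+1)]. *)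
Definition geo (e : int) a : {poly int} := \sum_(j < n.+1) (e *: 'X^a) ^+ j.

Definition other_colors : {poly int} :=
  \prod_(x | allowed (cell x) && (x.2 != ord_max)) geo 1 x.1.

(** Extending the weight by 1 to the other colors turns their factors into geometric sums that do
    not depend on [w]. *)
Lemma sum_last_color (w : nat -> nat -> int) :
  \sum_(la in calN k n) \prod_(1 <= a < n.+1) w a (parts la (a, ord_max)) =
  (other_colors * \prod_(1 <= a < n.+1) \sum_(j < n.+1) w a j *: 'X^(j * a))`_n.
Proof.
pose v p j := if p.2 == ord_max then w p.1 j else 1.
transitivity ((\prod_(x | allowed (cell x))
    \sum_(j < n.+1) v (cell x) j *: 'X^(j * x.1))`_n).
  rewrite -calN_genfun; apply: eq_bigr => la _.
  rewrite (prod_allowed (fun p => v p (parts la p))) [X in X * _]big1 ?mul1r.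
    by apply: eq_bigr => a _; rewrite /v eqxx.
  by move=> x /andP[_ /negbTE xm]; rewrite /v xm.
rewrite (prod_allowed (fun p => \sum_(j < n.+1) v p j *: 'X^(j * p.1))).
rewrite /other_colors; congr (polyseq (_ * _))`_n; apply: eq_bigr => x.
  move=> /andP[_ /negbTE xm]; apply: eq_bigr => j _.
  by rewrite /v xm !scale1r -exprM mulnC.
by move=> _; apply: eq_bigr => j _; rewrite /v eqxx.
Qed.

Lemma sum_sign_nb_last_color :
  \sum_(la in calN k n) (-1) ^+ nb_last_color la =
  (other_colors * \prod_(1 <= a < n.+1) geo (-1) a)`_n.
Proof.
have -> : \prod_(1 <= a < n.+1) geo (-1) a =
    \prod_(1 <= a < n.+1) \sum_(j < n.+1) (-1) ^+ j *: 'X^(j * a).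
  apply: eq_bigr => a _; apply: eq_bigr => j _.
  by rewrite exprZn -exprM mulnC.
rewrite -(sum_last_color (fun _ j => (-1) ^+ j)); apply: eq_bigr => la laN.
rewrite nb_last_colorE (bigID (fun x => allowed (cell x))) /= [X in (_ + X)%N]big1.
  rewrite addn0 expr_sum.
  rewrite (prod_allowed (fun p => (-1) ^+ (parts la p * (p.2 == ord_max))%N)).
  rewrite big1 ?mul1r; last by move=> x /andP[_ /negbTE ->]; rewrite muln0.
  by apply: eq_bigr => a _; rewrite eqxx muln1.
by move=> x /(calN_allowed laN) ->.
Qed.

Lemma sum_odd_lt m : (\sum_(0 <= a < m.*2 | odd a) a = m ^ 2)%N.
Proof.
elim: m => [|m IH]; first by rewrite big_geq.
rewrite doubleS big_mkcond !big_nat_recr //= -big_mkcond IH odd_double /=.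
by rewrite -addnn; lia.
Qed.

(** Amounts to [mex21 la >= 2m + 1], in a form that factors over the sizes. *)
Definition present m la :=
  all (fun a => odd a ==> ((a, ord_max : 'I_k) \in parts la)) (iota 0 m.*2).

(** Forcing size [a] to occur restricts its sum to [j >= 1], which costs [X^a]. The hypothesis keeps
    all forced sizes [1, 3, ..., 2m - 1] within [n]. *)
Lemma sum_present m : (m.*2 <= n.+1)%N ->
  \sum_(la in calN k n) (present m la)%:R =
  (other_colors * ('X^(m ^ 2) * \prod_(1 <= a < n.+1) geo 1 a))`_n.
Proof.
move=> mn.
pose b a := odd a && (a < m.*2)%N.
transitivity ((other_colors * \prod_(1 <= a < n.+1)
    \sum_(j < n.+1) (b a ==> (0 < j)%N)%:R *: 'X^(j * a))`_n).
  rewrite -(sum_last_color (fun a j => (b a ==> (0 < j)%N)%:R)).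
  apply: eq_bigr => la _.
  rewrite -(big_morph (fun b : bool => b%:R : int) (id2 := true) (op2 := andb)) //;
    last by case=> [] [].
  congr (nat_of_bool _)%:R; rewrite big_all.
  apply/allP/allP => [h a _|h a].
    apply/implyP => /andP[oa am]; rewrite mset_gt0.
    by apply: (implyP (h a _)); rewrite // mem_iota.
  rewrite mem_iota add0n => /andP[_ am]; apply/implyP => oa.
  have an : a \in index_iota 1 n.+1.
    by rewrite mem_index_iota (leq_trans am) // andbT; case: a oa {am}.
  by have := h a an; rewrite /b oa am mset_gt0.
apply: (_ : eqX n.+1 _ _) => //; apply: eqXM => //.
have -> : 'X^(m ^ 2) = \prod_(1 <= a < n.+1) (if b a then 'X^a else 1) :> {poly int}.
  rewrite -big_mkcond /= -expr_sum -sum_odd_lt (big_nat_widen _ _ n.+1) //.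
  by rewrite big_ltn_cond.
rewrite -big_split /= big_seq [X in eqX _ _ X]big_seq; apply: eqX_prod => a.
rewrite mem_index_iota => /andP[a0 _].
case: (b a) => /=; last first.
  rewrite mul1r /geo (eq_bigr (fun j : 'I_n.+1 => (1 *: 'X^a) ^+ j)) // => j _.
  by rewrite !scale1r -exprM mulnC.
(* Shifting the truncated sum by [X^a] overshoots by one term, [X^((n+1) a)], which is zero modulo
   [X^(n+1)] as [a > 0]. *)
have -> : 'X^a * geo 1 a =
    \sum_(j < n.+1) (0 < j)%N%:R *: 'X^(j * a) + 'X^(n.+1 * a) * 1 :> {poly int}.
  rewrite [in RHS]big_ord_recl scale0r add0r mulr1 /geo big_ord_recr mulrDr /=.
  rewrite !scale1r -exprM -exprD -mulnS mulnC big_distrr; congr (_ + _).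
  by apply: eq_bigr => j _; rewrite /= /bump add1n !scale1r -exprM -exprD -mulnS mulnC.
by apply: eqX_sym; apply: eqX_addX; rewrite leq_pmulr.
Qed.

End LastColor.

(** * The mex statistic and the comparison of signed sums *)

Section Mex.
Variables K n : nat.
Let k := K.+2.
Implicit Type la : cpart k n.

Lemma prod_geo (e : int) :
  eqX n.+1 (\prod_(1 <= a < n.+1) (1 - e *: 'X^a) * \prod_(1 <= a < n.+1) geo n e a) 1.
Proof.
rewrite -big_split.
suff : eqX n.+1 (\prod_(1 <= a < n.+1) ((1 - e *: 'X^a) * geo n e a))
    (\prod_(1 <= a < n.+1) 1) by rewrite big1_eq.
rewrite big_seq [X in eqX _ _ X]big_seq /=; apply: eqX_prod => a.
by rewrite mem_index_iota => /andP[a0 _]; apply: eqX_geometric.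
Qed.

(** With [G] and [H] inverse to [A] and [B], Gauss' identity [T B = A] yields
    [T G = T G B H = A G H = H]. *)
Lemma eqX_theta :
  eqX n.+1 ((1 + \sum_(1 <= j < n.+1) (-1) ^+ j * 'X^(j ^ 2) *+ 2)
         * \prod_(1 <= a < n.+1) geo n 1 a)
     (\prod_(1 <= a < n.+1) geo n (-1) a).
Proof.
set T := 1 + _; set G := \prod_(_ <= _ < _) _; set H := \prod_(_ <= _ < _) _.
have GE : eqX n.+1 (\prod_(1 <= a < n.+1) (1 - 'X^a) * G) 1.
  by have := prod_geo 1; under eq_bigr do rewrite scale1r.
have HE : eqX n.+1 (\prod_(1 <= a < n.+1) (1 + 'X^a) * H) 1.
  by have := prod_geo (-1); under eq_bigr do rewrite scaleN1r opprK.
have := @eqX_gauss int n; rewrite -/T.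
set A := \prod_(1 <= a < n.+1) _ in GE *.
set B := \prod_(1 <= a < n.+1) _ in HE * => TB.
have e1 : eqX n.+1 (T * G * (B * H)) (T * G).
  by rewrite -[X in eqX _ _ X]mulr1; apply: eqXM.
have e2 : eqX n.+1 (T * B * (G * H)) (A * (G * H)) by apply: eqXM; first exact: TB.
have e3 : eqX n.+1 (A * G * H) H.
  by rewrite -[X in eqX _ _ X]mul1r; apply: eqXM.
apply: eqX_trans (eqX_sym e1) _; apply: eqX_trans e3.
have -> : T * G * (B * H) = T * B * (G * H) by ring.
by rewrite -[X in eqX _ _ X]mulrA.
Qed.

(** For [j > M], [j^2 >= (M+1)^2 > 2M >= n]. The shorter sum stays in the range where [sum_present]
    applies. *)
Lemma eqX_theta_trunc (M : nat) : (n <= M.*2)%N -> (M <= n)%N ->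
  eqX n.+1 (1 + \sum_(1 <= j < n.+1) (-1) ^+ j * 'X^(j ^ 2) *+ 2 : {poly int})
    (1 + \sum_(1 <= j < M.+1) (-1) ^+ j * 'X^(j ^ 2) *+ 2).
Proof.
move=> nM Mn; rewrite (big_cat_nat (n := M.+1)) //= addrA.
rewrite -[X in eqX _ _ X]addr0; apply: eqXD => // i lt_in.
rewrite coef_sum coef0 big1_seq // => j /andP[_]; rewrite mem_index_iota => /andP[Mj _].
rewrite coefMn mulrC coefXnM; case: ifP => [_|]; first by rewrite mul0rn.
by move/negP => []; nia.
Qed.

Lemma mex21P la : [/\ odd (mex21 la), (mex21 la, ord_max : 'I_k) \notin parts la &
  forall a, odd a -> (a < mex21 la)%N -> (a, ord_max : 'I_k) \in parts la].
Proof.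
have candE m : odd m -> mex21_cand la m = ((m, ord_max : 'I_k) \notin parts la).
  move=> om; rewrite /mex21_cand om (odd_gt0 om) /=; congr (~~ _).
  apply/hasP/idP => [[[a c] pla /andP[/eqP/= <-]]|mla].
    by rewrite color_last => /eqP/= <-.
  by exists (m, ord_max : 'I_k) => //=; rewrite color_last !eqxx.
rewrite /mex21; case: ex_minnP => m cm min_m.
have om : odd m by case/and3P: cm.
split=> // [|a oa am]; first by rewrite -candE.
by apply: contraLR am; rewrite -candE // -leqNgt; apply: min_m.
Qed.

Lemma presentE m la : present m la = (m <= (mex21 la)./2)%N.
Proof.
have [om mla lt_mex] := mex21P la.
apply/allP/idP => [h|le_m a].
  rewrite leqNgt; apply/negP => lt_m; case/negP: mla.
  by apply: (implyP (h (mex21 la) _) om); rewrite mem_iota /=; lia.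
rewrite mem_iota add0n => /andP[_ am]; apply/implyP => oa; apply: lt_mex => //; lia.
Qed.

Lemma mex21_le la : ((mex21 la)./2 <= uphalf n)%N.
Proof.
have [om mla lt_mex] := mex21P la.
case r0 : (mex21 la)./2 => [//|r].
(* Here the mex is [2r + 3], so the preceding odd number [2r + 1] is a part, hence at most [n]. *)
have /mem_parts[x [e _] _] : (r.*2.+1, ord_max : 'I_k) \in parts la.
  by apply: lt_mex; rewrite /= ?odd_double //; lia.
by have := ltn_ord x.1; lia.
Qed.

(** A limit [M] independent of [r] allows the sum over [m] to be exchanged with the sum over
    partitions. *)
Lemma sign_sum r M : (r <= M)%N ->
  (-1) ^+ r = 1 + \sum_(1 <= m < M.+1) (-1) ^+ m * (m <= r)%N%:R *+ 2 :> int.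
Proof.
move=> rM; rewrite (big_cat_nat (n := r.+1)) //=.
rewrite [X in _ + (_ + X)]big1_seq ?addr0; last first.
  move=> m /andP[_]; rewrite mem_index_iota => /andP[rm _].
  by rewrite leqNgt rm mulr0 mul0rn.
rewrite (eq_big_nat _ _ (F2 := fun m => (-1) ^+ m *+ 2)); last first.
  by move=> m /andP[_]; rewrite ltnS => ->; rewrite mulr1.
elim: r {rM} => [|r IH]; first by rewrite big_geq.
by rewrite big_nat_recr //= addrA -IH exprS; ring.
Qed.

Lemma sum_sign_mex :
  \sum_(la in calN k n) (-1) ^+ (mex21 la)./2 =
  \sum_(la in calN k n) (-1) ^+ nb_last_color la :> int.
Proof.
rewrite sum_sign_nb_last_color.
(* Large enough for [mex21_le] and for the theta tail ([n <= 2M]), small enough for [sum_present]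
   ([2M <= n + 1]). *)
pose M := uphalf n.
rewrite [LHS](eq_bigr _ (fun la _ => sign_sum (mex21_le la))).
rewrite big_split exchange_big /=.
transitivity ((other_colors K n *
    ((1 + \sum_(1 <= j < M.+1) (-1) ^+ j * 'X^(j ^ 2) *+ 2)
         * \prod_(1 <= a < n.+1) geo n 1 a))`_n).
  rewrite mulrDl mul1r mulrDr coefD; congr (_ + _).
    have := @sum_present K n 0 isT; rewrite expr0 mul1r => <-.
    by apply: eq_bigr.
  rewrite mulr_suml mulr_sumr coef_sum; apply: eq_big_nat => m /andP[m0 mM].
  under eq_bigr => la _ do rewrite -presentE.
  rewrite sumrMnl -mulr_sumr sum_present; last by rewrite /M in mM; lia.
  rewrite -(rmorph_sign (@polyC int)) mulrnAl mulrnAr coefMn -mulrA.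
  by rewrite [in RHS]mulrCA coefCM.
apply: (_ : eqX n.+1 _ _) => //; apply: eqXM => //.
apply: eqX_trans eqX_theta; apply: eqXM => //; apply: eqX_sym.
by apply: eqX_theta_trunc; lia.
Qed.

End Mex.

Local Close Scope ring_scope.
Local Open Scope nat_scope.

Theorem theorem1p6 (k n : nat) (hk : 2 <= k) :
  N0 k n = P21 k n /\ N1 k n = P21bar k n.
Proof.
case: k hk => [|[|K]] // _.
have [e0 e1] := parity_count (esym (sum_sign_mex K n)).
(* The mex is odd, and [2r + 1] is 1 or 3 modulo 4 according as [r] is even or odd. *)
split; [rewrite [LHS]e0|rewrite [LHS]e1]; apply: eq_card => la; rewrite !inE;
  congr (_ && _); have [om _ _] := mex21P la; lia.
Qed.
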